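(* Let $G$ be a finite group, let $p$ be a prime divisor of the order of $G$, and let $(K,R,k)$ be a $p$-modular system with $\mathrm{char}(K)=0$ and $K$ sufficiently large relative to $G$. Let $x_{1},\dotsc,x_{r}$ be representatives of the $p$-regular conjugacy classes of $G$. Let $\varphi$ be a Brauer character of $G$ (relative to $p$), with domain extended to the $p$-regular torsion units of augmentation one in $RG$ as described in the context, and let $u$ be a $p$-regular torsion unit in $\mathrm{V}(RG)$. Then \[ \varphi(u)=\sum_{l=1}^{r}\varepsilon_{x_{l}}(u)\,\varphi(x_{l}). \]
   Context: A $p$-modular system $(K,R,k)$ consists of a discrete valuation ring $R$ with quotient field $K$ and residue field $k=R/\pi R$ of characteristic $p$, where $\pi$ is a prime element of $R$. ''Sufficiently large relative to $G$'' means that $K$ contains a primitive root of unity of order equal to the exponent of $G$; then $k$ is also sufficiently large relative to $G$. $\mathrm{V}(RG)$ is the group of units of the group ring $RG$ of augmentation (sum of coefficients) one. A torsion unit is a unit of finite order; it is called $p$-regular if $p$ does not divide its order. An element or conjugacy class of $G$ is $p$-regular if its order (the order of its elements) is not divisible by $p$. For $u=\sum_{g\in G}a_{g}g\in RG$ and $x\in G$, the partial augmentation of $u$ with respect to $x$ is $\varepsilon_{x}(u)=\sum_{g\in x^{G}}a_{g}$, where $x^{G}$ is the conjugacy class of $x$ in $G$. Extended Brauer characters: Let $\Theta:G\rightarrow\mathrm{GL}(n,k)$ be a modular representation. Via the natural map $R\rightarrow k$, regard $\Theta$ as a ring homomorphism from $RG$ to the $n\times n$ matrices over $k$. For a $p$-regular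 torsion unit $u\in\mathrm{V}(RG)$, the eigenvalues of $\Theta(u)$ (counted with multiplicity) are roots of unity of order relatively prime to $p$ (lying in $k$, where, if necessary, $(K,R,k)$ is enlarged so that $K$ contains a primitive root of unity of order equal to the order of $u$). The map $R\rightarrow k$ induces a bijection between the roots of unity in $R$ and in $k$ of order dividing the order of $u$. Replace each eigenvalue by the corresponding root of unity in $R$; the sum of the resulting roots of unity is $\varphi(u)$. The function $\varphi$ so defined is the (extended) Brauer character afforded by $\Theta$; its restriction to the $p$-regular elements of $G$ is the usual Brauer character. *)

(* Defs.v *)
From HB Require Import structures.
From mathcomp Require Import all_boot all_order all_fingroup all_algebra.
From mathcomp Require Import all_solvable all_character.
From mathcomp Require Import boolp classical_sets.

Set Implicit Arguments.
Unset Strict Implicit.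
Unset Printing Implicit Defensive.

Import Order.TTheory GRing.Theory Num.Theory.

Local Open Scope ring_scope.

(* The group ring RG, for a finite group given as a finGroupType.  The alias
   hides the pointwise ring structure of {ffun gT -> R}: multiplication here is
   convolution. *)
Definition gpring (R : nzRingType) (gT : finGroupType) := {ffun gT -> R}.

HB.instance Definition _ (R : nzRingType) (gT : finGroupType) :=
  GRing.Zmodule.copy (gpring R gT) {ffun gT -> R}.

Section GroupRing.
Variables (R : nzRingType) (gT : finGroupType).
Implicit Types u v w : gpring R gT.

Definition gpring_elt (g : gT) : gpring R gT := [ffun h => (h == g)%:R].

Definition gpring_mul u v : gpring R gT :=
  [ffun g : gT => \sum_(h : gT) u h * v (h^-1 * g)%g].

Fact gpring_mulA : associative gpring_mul.
Proof.
move=> u v w; apply/ffunP => g; rewrite !ffunE.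
under eq_bigr => h _ do rewrite ffunE mulr_sumr.
under [RHS]eq_bigr => h _ do rewrite ffunE mulr_suml.
rewrite [RHS]exchange_big /=; apply: eq_bigr => h _.
rewrite [RHS](reindex_inj (mulgI h)) /=; apply: eq_bigr => j _.
by rewrite mulrA mulKg invMg mulgA.
Qed.

Fact gpring_mul1 : left_id (gpring_elt 1%g) gpring_mul.
Proof.
move=> u; apply/ffunP => g; rewrite ffunE (bigD1 1%g) //= big1.
  by rewrite ffunE eqxx mul1r invg1 mul1g addr0.
by move=> h /negPf nh1; rewrite ffunE nh1 mul0r.
Qed.

Fact gpring_mulr1 : right_id (gpring_elt 1%g) gpring_mul.
Proof.
move=> u; apply/ffunP => g; rewrite ffunE (bigD1 g) //= big1.
  by rewrite ffunE mulVg eqxx mulr1 addr0.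
by move=> h nhg; rewrite ffunE -eq_mulVg1 (negPf nhg) mulr0.
Qed.

Fact gpring_mulDl : left_distributive gpring_mul +%R.
Proof.
move=> u v w; apply/ffunP => g; rewrite !ffunE -big_split /=.
by apply: eq_bigr => h _; rewrite ffunE mulrDl.
Qed.

Fact gpring_mulDr : right_distributive gpring_mul +%R.
Proof.
move=> u v w; apply/ffunP => g; rewrite !ffunE -big_split /=.
by apply: eq_bigr => h _; rewrite ffunE mulrDr.
Qed.

Fact gpring_1neq0 : gpring_elt 1%g != 0.
Proof.
by apply/eqP => /ffunP/(_ 1%g)/eqP; rewrite !ffunE eqxx oner_eq0.
Qed.

HB.instance Definition _ := GRing.Zmodule_isNzRing.Build (gpring R gT)
  gpring_mulA gpring_mul1 gpring_mulr1 gpring_mulDl gpring_mulDr gpring_1neq0.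

Definition augmentation u : R := \sum_g u g.

Definition partial_augmentation u (x : gT) : R :=
  \sum_(g in (x ^: [set: gT])%g) u g.

(* The group V(RG); invertibility is spelled out since gpring carries no
   unitRingType structure. *)
Definition normalized_unit u : Prop :=
  (exists v, u * v = 1 /\ v * u = 1) /\ augmentation u = 1.

Definition torsion u : Prop := exists2 n, (0 < n)%N & u ^+ n = 1.

(* The default value 0 is only taken when u is not torsion. *)
Definition torsion_order u : nat :=
  xget 0%N (fun n => [/\ (0 < n)%N, u ^+ n = 1
                       & forall m, (0 < m)%N -> u ^+ m = 1 -> (n <= m)%N]).

Definition p_regular_torsion (p : nat) u : Prop :=
  torsion u /\ ~~ (p %| torsion_order u)%N.

End GroupRing.

Definition p_regular_elt (gT : finGroupType) (p : nat) (g : gT) : bool :=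
  ~~ (p %| #[g]%g)%N.

Definition p_regular_class_reps (gT : finGroupType) (p r : nat)
    (x : 'I_r -> gT) : Prop :=
  [/\ forall l, p_regular_elt p (x l),
      forall l m, x m \in (x l ^: [set: gT])%g -> l = m
    & forall g, p_regular_elt p g -> exists l, g \in (x l ^: [set: gT])%g].

(* v is only meaningful on nonzero elements; its value at 0 is irrelevant. *)
Definition discrete_valuation (K : fieldType) (v : K -> int) : Prop :=
  [/\ forall x y, x != 0 -> y != 0 -> v (x * y) = v x + v y,
      forall x y, x != 0 -> y != 0 -> x + y != 0 ->
        Order.min (v x) (v y) <= v (x + y)
    & forall n : int, exists2 x, x != 0 & v x = n].

Definition quotient_field (R : idomainType) (K : fieldType)
    (i : {rmorphism R -> K}) : Prop :=
  injective i /\ forall x, exists a b, b != 0 /\ x = i a / i b.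

Definition discrete_valuation_ring (R : idomainType) (K : fieldType)
    (i : {rmorphism R -> K}) : Prop :=
  quotient_field i /\
  exists2 v : K -> int, discrete_valuation v
    & forall x, x != 0 -> ((exists a, x = i a) <-> 0 <= v x).

Definition rdivides (R : idomainType) (a b : R) : Prop := exists c, b = a * c.

Definition prime_element (R : idomainType) (a : R) : Prop :=
  [/\ a != 0, a \isn't a GRing.unit
    & forall b c, rdivides a (b * c) -> rdivides a b \/ rdivides a c].

(* A p-modular system (K, R, k).  The identification k = R / pi R is expressed
   by a surjective morphism R -> k with kernel pi R. *)
Record pmodular_system (p : nat) := PModularSystem {
  msK : fieldType;
  msR : idomainType;
  msk : fieldType;
  ms_incl : {rmorphism msR -> msK};
  ms_red : {rmorphism msR -> msk};
  ms_pi : msR;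
  _ : discrete_valuation_ring ms_incl;
  _ : prime_element ms_pi;
  _ : forall b : msk, exists a, ms_red a = b;
  _ : forall a : msR, ms_red a = 0 <-> rdivides ms_pi a;
  _ : p \in [pchar msk]
}.

(* An enlargement of a p-modular system; the field morphisms are injective,
   hence so is enl_R. *)
Record enlargement (p : nat) (S S' : pmodular_system p) := Enlargement {
  enl_K : {rmorphism msK S -> msK S'};
  enl_R : {rmorphism msR S -> msR S'};
  enl_k : {rmorphism msk S -> msk S'};
  _ : forall a : msR S, enl_K (ms_incl S a) = ms_incl S' (enl_R a);
  _ : forall a : msR S, enl_k (ms_red S a) = ms_red S' (enl_R a)
}.

Definition sufficiently_large (K : fieldType) (gT : finGroupType) : Prop :=
  exists z : K, (exponent [set: gT]).-primitive_root z.

(* The eigenvalues of A with multiplicity, and nil when the characteristic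
   polynomial of A does not split over F. *)
Definition eigenvalues (F : fieldType) (n : nat) (A : 'M[F]_n) : seq F :=
  xget [::] (fun s => char_poly A = \prod_(a <- s) ('X - a%:P)).

Definition lift_root_of_unity (R : idomainType) (k : fieldType)
    (red : {rmorphism R -> k}) (m : nat) (a : k) : R :=
  xget 0 (fun w => w ^+ m = 1 /\ red w = a).

Section BrauerCharacter.
Variables (p : nat) (gT : finGroupType) (n : nat).
Variables (S S' : pmodular_system p) (E : enlargement S S').
Variable Theta : mx_representation (msk S) [set: gT] n.

Definition gpring_repr (u : gpring (msR S) gT) : 'M[msk S]_n :=
  \sum_(g : gT) ms_red S (u g) *: Theta g.

(* The extended Brauer character afforded by Theta, with values in the valuation
   ring of an enlargement S' of S.  It is the intended value at a p-regular
   torsion unit u when msK S' has a primitive root of unity of order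
   torsion_order u. *)
Definition brauer_character (u : gpring (msR S) gT) : msR S' :=
  \sum_(a <- eigenvalues (map_mx (enl_k E) (gpring_repr u)))
     lift_root_of_unity (ms_red S') (torsion_order u) a.

End BrauerCharacter.

(* Main.v *)
Require Import Defs.
From mathcomp Require Import all_boot all_order all_fingroup all_algebra.
From mathcomp Require Import all_solvable all_character.
From mathcomp Require Import boolp classical_sets.

Set Implicit Arguments.
Unset Strict Implicit.
Unset Printing Implicit Defensive.

Import Order.TTheory GRing.Theory Num.Theory.

Local Open Scope ring_scope.

(** Write F(g) for phi(g) when g is p-regular and 0 otherwise.  The statement
    says that phi(u) = sum_g u_g F(g), a sum that can be cut along the p-regular
    classes.  Both sides are compared pi-adically, as follows.

    Lift every matrix Theta(g) entrywise to a matrix T_g over the valuation ring;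
    g |-> T_g need not be multiplicative.  The matrix A = sum_g u_g T_g lifts
    Theta(u), which is diagonalizable with eigenvalues of order prime to p, so
    the trace of A^(p^N) differs from the sum of the p^N-th powers of the lifted
    eigenvalues by a multiple of pi^(N+1) ([rdivides_trace_exp_diag]).  When p^N = 1 modulo the order
    of u, that sum is phi(u).

    On the other hand, expanding A^(p^N) gives one term for every word of length
    p^N in the elements of G, and expanding u^(p^N) = u inside sum_g u_g F(g)
    gives one term for every such word as well.  Both kinds of terms are invariant
    under rotation of words, so they can be collected along rotation orbits.  An
    orbit of size p^j consists of the rotations of a word repeated p^(N-j) times:
    it brings a factor p^j, and its terms compare tr(M^(p^(N-j))) with
    F(g^(p^(N-j))), where M lifts Theta(g).  These two agree modulo a power of pi
    growing with N-j, because g^(p^(N-j)) is p-regular as soon as p^(N-j) is at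
    least the p-part of #|G|.  Hence every orbit contributes a multiple of
    pi^(N-a), where p^a is the p-part of #|G| ([trace_word_congruence]).  Letting
    N grow, the two sides differ by an element of all the ideals pi^c R, which
    is 0.

    This handles the p-singular classes at the same time: their contribution
    to the limit is 0 because F vanishes on them. *)

(** * Words and their rotations *)

Definition repeat_word (T : Type) (q : nat) (v : seq T) : seq T :=
  flatten (nseq q v).

(** A nonempty word [y] as below starts with [v], and removing this prefix leaves a
    word that still commutes with [v]. *)
Lemma commuting_word_repeat (T : eqType) (d k : nat) (v y : seq T) :
  size v = d -> size y = (k * d)%N -> v ++ y = y ++ v -> y = repeat_word k v.
Proof.
move=> sv; elim: k y => [|k IHk] y; first by case: y.
rewrite mulSn => sy eq_vy.
have dy : y = v ++ drop d y.
  rewrite -{1}(cat_take_drop d y); congr (_ ++ _).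
  have := congr1 (take d) eq_vy.
  by rewrite take_size_cat // takel_cat ?sy ?leq_addr // => ->.
rewrite dy in eq_vy *; rewrite [RHS]/repeat_word /=; congr (_ ++ _).
apply: IHk; first by rewrite size_drop sy addKn.
by move/eqP: eq_vy; rewrite -!catA eqseq_cat // eqxx /= => /eqP.
Qed.

(** Being fixed by the rotation of [d] letters means that the prefix of length [d]
    commutes with the rest of the word. *)
Lemma rot_fixed_repeat (T : eqType) (d q : nat) (w : seq T) :
  (0 < q)%N -> size w = (q * d)%N -> seq.rot d w = w ->
  w = repeat_word q (take d w).
Proof.
case: q => // q _; rewrite mulSn => sw rot_w.
have std : size (take d w) = d by rewrite size_takel // sw leq_addr.
rewrite -{1}(cat_take_drop d w) /repeat_word /=; congr (_ ++ _).
apply: (commuting_word_repeat std); first by rewrite size_drop sw addKn.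
by rewrite cat_take_drop -{1}rot_w.
Qed.

(** The sum is collected along the orbits of rotation by one letter: an orbit has
    [d] elements for some divisor [d] of [n], a word in it is fixed by the
    rotation of [d] letters, hence is a prefix of length [d] repeated, and [f]
    is constant on the orbit. *)
Lemma cyclic_word_sum (V : zmodType) (T : finType) (n : nat)
    (f : seq T -> V) (Q : V -> Prop) :
    (0 < n)%N ->
    (forall v w, f (v ++ w) = f (w ++ v)) ->
    Q 0 -> (forall a b, Q a -> Q b -> Q (a + b)) ->
    (forall d q v, (d * q)%N = n -> size v = d -> Q (f (repeat_word q v) *+ d)) ->
  Q (\sum_(w : n.-tuple T) f w).
Proof.
move=> n_gt0 f_cyc Q0 QD Qf.
have rot1_inj : injective (fun w : n.-tuple T => [tuple of seq.rot 1 w]).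
  by move=> v w /(congr1 val) /= /rot_inj /val_inj.
pose s := perm rot1_inj.
have s_iter i w : (i <= n)%N -> val ((s ^+ i)%g w) = seq.rot i w.
  elim: i => [|i IHi] i_le; first by rewrite expg0 perm1 rot0.
  rewrite expgSr permM permE /= IHi 1?ltnW // -rotD ?size_tuple //.
have s_n : (s ^+ n = 1)%g.
  apply/permP => w; apply: val_inj; rewrite s_iter // perm1.
  by rewrite -{1}(size_tuple w) rot_size.
have f_s i w : f ((s ^+ i)%g w) = f w.
  elim: i => [|i IHi]; first by rewrite expg0 perm1.
  rewrite expgSr permM permE /= -IHi /seq.rot f_cyc cat_take_drop //.
rewrite (partition_big (porbit s) (mem (porbits s))) /=; last first.
  by move=> w _; apply: imset_f.
apply: big_ind => // _ /imsetP[w _ ->].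
rewrite (eq_bigl (mem (porbit s w))); last by move=> v; rewrite /= eq_porbit_mem.
rewrite (eq_bigr (fun=> f w)); last by move=> _ /porbitP[i ->]; rewrite f_s.
rewrite sumr_const.
set d := #|porbit s w|.
have d_dvd : (d %| n)%N.
  rewrite /d porbitE; apply: dvdn_trans (dvdn_orbit _ _ _) _.
  by rewrite -orderE order_dvdn s_n.
have d_gt0 : (0 < d)%N by rewrite lt0n card_porbit_neq0.
have [q def_n] := dvdnP d_dvd.
have q_gt0 : (0 < q)%N by move: n_gt0; rewrite def_n muln_gt0 => /andP[].
have rot_w : seq.rot d w = w :> seq T.
  have := s_iter d w (dvdn_leq n_gt0 d_dvd).
  by rewrite permX iter_porbit => <-.
have sw : size w = (q * d)%N := etrans (size_tuple w) def_n.
have d_le := dvdn_leq n_gt0 d_dvd; clearbody d.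
rewrite (rot_fixed_repeat q_gt0 sw rot_w).
by apply: Qf; rewrite 1?mulnC // size_takel ?size_tuple.
Qed.

Lemma expr_sum_words (R : pzSemiRingType) (T : finType) (a : T -> R) n :
  (\sum_i a i) ^+ n = \sum_(w : n.-tuple T) \prod_(i <- w) a i.
Proof.
transitivity (\prod_(i < n) \sum_j a j).
  by rewrite big_const_ord -Monoid.iteropE.
rewrite bigA_distr_bigA.
rewrite (reindex (fun w : n.-tuple T => [ffun i => tnth w i])) /=.
  by apply: eq_bigr => w _; rewrite big_tuple; apply: eq_bigr => i _; rewrite ffunE.
exists (fun g : {ffun 'I_n -> T} => [tuple g i | i < n]) => [w|g] _.
  by apply: eq_from_tnth => i; rewrite tnth_mktuple ffunE.
by apply/ffunP => i; rewrite ffunE tnth_mktuple.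
Qed.

Lemma prod_repeat_word (R : pzSemiRingType) (T : Type) (a : T -> R) q v :
  \prod_(i <- repeat_word q v) a i = (\prod_(i <- v) a i) ^+ q.
Proof.
elim: q => [|q IHq]; first by rewrite big_nil.
by rewrite /repeat_word /= big_cat IHq exprS.
Qed.

Lemma prodg_repeat_word (gT : finGroupType) q (v : seq gT) :
  (\prod_(g <- repeat_word q v) g = (\prod_(g <- v) g) ^+ q)%g.
Proof.
elim: q => [|q IHq]; first by rewrite big_nil.
by rewrite /repeat_word /= big_cat IHq expgS.
Qed.

(** * Congruences between traces of powers *)

Section Divisibility.
Variable R : idomainType.
Implicit Types a b c pi : R.

Lemma rdivides1 a : rdivides 1 a.
Proof. by exists a; rewrite mul1r. Qed.

Lemma rdivides0 a : rdivides a 0.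
Proof. by exists 0; rewrite mulr0. Qed.

Lemma rdividesD a b c : rdivides a b -> rdivides a c -> rdivides a (b + c).
Proof. by move=> [x ->] [y ->]; exists (x + y); rewrite mulrDr. Qed.

Lemma rdividesN a b : rdivides a b -> rdivides a (- b).
Proof. by move=> [x ->]; exists (- x); rewrite mulrN. Qed.

Lemma rdivides_mull a b c : rdivides a c -> rdivides a (b * c).
Proof. by move=> [x ->]; exists (b * x); rewrite mulrCA. Qed.

Lemma rdividesM a b c d : rdivides a c -> rdivides b d -> rdivides (a * b) (c * d).
Proof. by move=> [x ->] [y ->]; exists (x * y); rewrite mulrACA. Qed.

Lemma rdividesX a b i : rdivides a b -> rdivides (a ^+ i) (b ^+ i).
Proof. by move=> [x ->]; exists (x ^+ i); rewrite exprMn. Qed.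

Lemma rdivides_leX pi i j a :
  (i <= j)%N -> rdivides (pi ^+ j) a -> rdivides (pi ^+ i) a.
Proof. by move=> ij [x ->]; exists (pi ^+ (j - i) * x); rewrite mulrA -exprD subnKC. Qed.

Lemma rdivides_trans b a c : rdivides a b -> rdivides b c -> rdivides a c.
Proof. by move=> [x ->] [y ->]; exists (x * y); rewrite mulrA. Qed.

Lemma rdivides_sub_trans b a c d :
  rdivides d (a - b) -> rdivides d (b - c) -> rdivides d (a - c).
Proof. by move=> ab bc; rewrite -(subrK b a) -addrA; apply: rdividesD. Qed.

Lemma rdivides_subC a b c : rdivides a (b - c) -> rdivides a (c - b).
Proof. by move/rdividesN; rewrite opprB. Qed.

End Divisibility.

Lemma mulr_mxE (R : pzSemiRingType) n (A B : 'M[R]_n) : A * B = A *m B.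
Proof. by []. Qed.

Lemma scalemx_exp (R : comPzRingType) n (a : R) (Z : 'M[R]_n) q :
  (a *: Z) ^+ q = a ^+ q *: Z ^+ q.
Proof.
elim: q => [|q IHq]; first by rewrite !expr0 scale1r.
by rewrite !exprS IHq !mulr_mxE -scalemxAl -scalemxAr scalerA.
Qed.

Lemma mxtrace_prod_cat (R : comPzRingType) n (T : Type) (a : T -> 'M[R]_n) v w :
  \tr (\prod_(i <- v ++ w) a i) = \tr (\prod_(i <- w ++ v) a i).
Proof. by rewrite !big_cat /= !mulr_mxE mxtrace_mulC. Qed.

(** The difference is the sum, over the words in the letters [Y] and [pi *: Z]
    other than the constant word in [Y], of the trace of the product of the
    letters.  A rotation orbit of size [p ^ j] contributes [p ^ j] times the trace
    of a [p ^ (t - j)]-th power of a matrix divisible by [pi], hence a multiple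
    of [pi ^+ (j + p ^ (t - j))]. *)
Lemma rdivides_trace_exp (R : idomainType) (pi : R) (p n t : nat)
    (Y Z : 'M[R]_n) :
    prime p -> rdivides pi p%:R ->
  rdivides (pi ^+ t.+1)
    (\tr ((Y + pi *: Z) ^+ (p ^ t)) - \tr (Y ^+ (p ^ t))).
Proof.
move=> p_pr pi_p.
pose a (b : bool) := if b then pi *: Z else Y.
pose f (w : seq bool) := if has id w then \tr (\prod_(b <- w) a b) else 0.
have -> : \tr ((Y + pi *: Z) ^+ (p ^ t)) - \tr (Y ^+ (p ^ t))
    = \sum_(w : (p ^ t).-tuple bool) f w.
  have -> : Y + pi *: Z = \sum_b a b by rewrite big_bool addrC.
  rewrite expr_sum_words raddf_sum (bigD1 [tuple of nseq (p ^ t) false]) //=.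
  rewrite [RHS](bigD1 [tuple of nseq (p ^ t) false]) //= big_nseq -Monoid.iteropE.
  rewrite -[iterop _ _ _ _]/(Y ^+ (p ^ t)) addrAC subrr add0r.
  rewrite {1}/f has_nseq andbF add0r; apply: eq_bigr => w w_neq.
  rewrite /f ifT //; apply: contraNT w_neq => /hasPn w_false.
  apply/eqP/val_inj => /=; rewrite -[in RHS](size_tuple w).
  by apply/all_pred1P/allP => b /w_false; case: b.
apply: cyclic_word_sum => //; first by rewrite expn_gt0 prime_gt0.
- by move=> v w; rewrite /f !has_cat orbC mxtrace_prod_cat.
- exact: rdivides0.
- by move=> b c; apply: rdividesD.
move=> d q v dq _; rewrite /f; case: ifP => [hasv|]; last first.
  by rewrite mul0rn => _; apply: rdivides0.
have [Z' defZ'] : exists Z', \prod_(b <- v) a b = pi *: Z'.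
  have /hasP[b] : has id v.
    apply: contraTT hasv => /hasPn v_false; apply/hasPn => b.
    by case/flattenP => x /nseqP[-> _]; apply: v_false.
  case: b => // /splitPr[v1 v2] _; rewrite big_cat big_cons /=.
  exists ((\prod_(b <- v1) a b) *m (Z *m \prod_(b <- v2) a b)).
  by rewrite !mulr_mxE -scalemxAl -scalemxAr.
rewrite prod_repeat_word defZ' scalemx_exp mxtraceZ.
have [j j_le def_d] : exists2 j, (j <= t)%N & d = (p ^ j)%N.
  by apply/dvdn_pfactor => //; apply/dvdnP; exists q; rewrite mulnC.
have def_q : q = (p ^ (t - j))%N.
  apply/eqP; rewrite -(eqn_pmul2l (_ : 0 < d)%N) ?dq ?def_d -?expnD ?subnKC //.
  by rewrite expn_gt0 prime_gt0.
rewrite -mulr_natr mulrC mulrA.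
apply: (@rdivides_trans _ (d%:R * pi ^+ q)); last by exists (\tr (Z' ^+ q)).
apply: (@rdivides_leX _ _ _ (j + q)).
  by rewrite -{1}(subnKC j_le) -addnS leq_add2l def_q ltn_expl // prime_gt1.
rewrite exprD; apply: rdividesM; last by exists 1; rewrite mulr1.
by rewrite def_d natrX; apply: rdividesX.
Qed.

Lemma mxtrace_exp_mulC (R : comPzRingType) (n q : nat) (A B : 'M[R]_n) :
  (0 < q)%N -> \tr ((A *m B) ^+ q) = \tr ((B *m A) ^+ q).
Proof.
case: q => // q _.
have -> : (A *m B) ^+ q.+1 = A *m ((B *m A) ^+ q *m B).
  elim: q => [|q IHq]; first by rewrite expr1 expr0 mul1mx.
  by rewrite exprS IHq [in RHS]exprS !mulr_mxE !mulmxA.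
by rewrite mxtrace_mulC exprSr !mulr_mxE !mulmxA.
Qed.

Lemma diag_mx_exp (R : comNzRingType) (n q : nat) (d : 'rV[R]_n) :
  diag_mx d ^+ q = diag_mx (map_mx (fun a => a ^+ q) d).
Proof.
elim: q => [|q IHq].
  rewrite expr0 -[1]diag_const_mx; congr diag_mx.
  by apply/rowP => i; rewrite !mxE expr0.
rewrite exprS IHq mulr_mxE mulmx_diag; congr diag_mx.
by apply/rowP => i; rewrite !mxE exprS.
Qed.

Section Reduction.
Variables (R : idomainType) (k : fieldType) (red : {rmorphism R -> k}).
Variables (pi : R) (p : nat).
Hypothesis p_pr : prime p.
Hypothesis red_surj : forall b, exists a, red a = b.
Hypothesis red_ker : forall a, red a = 0 <-> rdivides pi a.
Hypothesis pchar_k : p \in [pchar k].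

Lemma rdivides_pi_p : rdivides pi p%:R.
Proof. by apply/red_ker; rewrite rmorph_nat (pcharf0 pchar_k). Qed.

Lemma lift_mx m n (B : 'M[k]_(m, n)) : exists A, map_mx red A = B.
Proof.
have [sec secK] := choice red_surj.
by exists (map_mx sec B); apply/matrixP => i j; rewrite !mxE secK.
Qed.

Lemma eq_red_mx m n (A B : 'M[R]_(m, n)) :
  map_mx red A = map_mx red B -> exists Z, A = B + pi *: Z.
Proof.
move=> /matrixP eqAB.
have quo (ij : 'I_m * 'I_n) : exists c, A ij.1 ij.2 - B ij.1 ij.2 = pi * c.
  by apply/red_ker; have := eqAB ij.1 ij.2; rewrite rmorphB !mxE => ->; rewrite subrr.
have [z zP] := choice quo.
exists (\matrix_(i, j) z (i, j)); apply/matrixP => i j.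
by rewrite !mxE -(zP (i, j)) addrC subrK.
Qed.

Lemma rdivides_trace_exp_red n t (A B : 'M[R]_n) :
  map_mx red A = map_mx red B ->
  rdivides (pi ^+ t.+1) (\tr (A ^+ (p ^ t)) - \tr (B ^+ (p ^ t))).
Proof.
by case/eq_red_mx => Z ->; apply: rdivides_trace_exp => //; apply: rdivides_pi_p.
Qed.

(** With lifts [P'], [Q'] of [P], [Q], both [A] and [P' *m diag_mx d *m Q'] lift the
    same matrix.  The trace of a power of the latter is that of the power of
    [diag_mx d *m (Q' *m P')], and [Q' *m P'] lifts the identity matrix, so
    that this last product has the same reduction as [diag_mx d]. *)
Lemma rdivides_trace_exp_diag n t (A : 'M[R]_n) (P Q : 'M[k]_n) (d : 'rV[R]_n) :
  Q *m P = 1%:M -> map_mx red A = P *m diag_mx (map_mx red d) *m Q ->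
  rdivides (pi ^+ t.+1) (\tr (A ^+ (p ^ t)) - \sum_i d 0 i ^+ (p ^ t)).
Proof.
move=> QP redA; have [P' defP] := lift_mx P; have [Q' defQ] := lift_mx Q.
have q_gt0 : (0 < p ^ t)%N by rewrite expn_gt0 prime_gt0.
apply: (@rdivides_sub_trans _ (\tr ((P' *m diag_mx d *m Q') ^+ (p ^ t)))).
  by apply: rdivides_trace_exp_red; rewrite redA !map_mxM map_diag_mx defP defQ.
have -> : \sum_i d 0 i ^+ (p ^ t) = \tr (diag_mx d ^+ (p ^ t)).
  by rewrite diag_mx_exp mxtrace_diag; apply: eq_bigr => i _; rewrite mxE.
rewrite -mulmxA mxtrace_exp_mulC //; apply: rdivides_trace_exp_red.
by rewrite !map_mxM map_diag_mx defP defQ -mulmxA QP mulmx1.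
Qed.

End Reduction.

(** * Discrete valuations and roots of unity *)

Section Valuation.
Variables (K : fieldType) (v : K -> int).
Hypothesis dv : discrete_valuation v.

Lemma valuation1 : v 1 = 0.
Proof.
have [vM _ _] := dv; have := vM 1 1 (oner_neq0 _) (oner_neq0 _).
by rewrite mulr1 => /eqP; rewrite -{1}[v 1]addr0 (inj_eq (addrI _)) => /eqP <-.
Qed.

Lemma valuationX x n : x != 0 -> v (x ^+ n) = v x *+ n.
Proof.
have [vM _ _] := dv; move=> x0; elim: n => [|n IHn]; first exact: valuation1.
by rewrite exprS vM ?expf_neq0 // IHn mulrS.
Qed.

End Valuation.

(** A nonzero multiple of [pi ^+ c] has valuation at least [c], since [pi] has
    positive valuation. *)
Lemma rdivides_all_powers_eq0 (R : idomainType) (K : fieldType)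
    (i : {rmorphism R -> K}) (pi a : R) :
    discrete_valuation_ring i -> prime_element pi ->
    (forall c, rdivides (pi ^+ c) a) -> a = 0.
Proof.
move=> [[inj_i _] [v dv vP]] [pi0 pi_nunit _] pi_a.
have i0 b : b != 0 -> i b != 0 by rewrite -(rmorph0 i) (inj_eq inj_i).
have v_ge0 b : b != 0 -> 0 <= v (i b).
  by move=> /i0 ib; apply/vP => //; exists b.
have [vM _ _] := dv.
have vpi : 1 <= v (i pi).
  rewrite -gtz0_ge1 lt_neqAle v_ge0 // andbT; apply: contra pi_nunit => /eqP vpi.
  have vV : v (i pi)^-1 = 0.
    have := vM _ _ (i0 _ pi0) (invr_neq0 (i0 _ pi0)).
    by rewrite divff ?i0 // (valuation1 dv) -vpi add0r.
  have [b def_b] : exists b, (i pi)^-1 = i b by apply/vP; rewrite ?vV ?invr_neq0 ?i0.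
  apply/unitrP; exists b; suff pib: pi * b = 1 by rewrite mulrC pib.
  by apply: inj_i; rewrite rmorphM -def_b divff ?i0 // rmorph1.
apply/eqP/negPn/negP => a0.
have [b def_a] := pi_a `|v (i a)|.+1%N.
have b0 : b != 0 by apply: contraNneq a0 => b0; rewrite def_a b0 mulr0.
have : v (i a) < (`|v (i a)|.+1)%:Z by rewrite -addn1 PoszD ltzD1 ler_norm.
rewrite {1}def_a rmorphM vM ?i0 ?expf_neq0 // rmorphXn (valuationX dv) ?i0 //.
rewrite ltNge => /negP; apply.
rewrite -[X in X <= _]addr0 lerD ?v_ge0 //.
by rewrite -[X in X%:Z]muln1 PoszM mulrC -mulr_natr natz ler_wpM2r.
Qed.

(** Roots of unity have valuation 0, so they lie in the valuation ring. *)
Lemma prim_root_valuation_ring (R : idomainType) (K : fieldType)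
    (i : {rmorphism R -> K}) (m : nat) (z : K) :
  discrete_valuation_ring i -> m.-primitive_root z ->
  exists w : R, m.-primitive_root w.
Proof.
move=> [[inj_i _] [v dv vP]] z_prim; have m_gt0 := prim_order_gt0 z_prim.
have zm := prim_expr_order z_prim.
have z0 : z != 0 by rewrite -unitfE -(unitrX_pos _ m_gt0) zm unitr1.
have [w def_z] : exists w, z = i w.
  apply/vP => //; rewrite -(pmulrn_lge0 _ m_gt0) -(valuationX dv) // zm.
  by rewrite (valuation1 dv).
have wm : w ^+ m = 1 by apply: inj_i; rewrite rmorphXn -def_z zm rmorph1.
have [m' w_prim m'_m] := prim_order_exists m_gt0 wm.
exists w; suff /eqP eq_m : m' == m by rewrite -eq_m.
rewrite eqn_dvd m'_m (prim_order_dvd z_prim) def_z -rmorphXn.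
by rewrite (prim_expr_order w_prim) rmorph1 eqxx.
Qed.

Section Unity.
Variables (R : idomainType) (k : fieldType) (red : {rmorphism R -> k}).
Variables (p m : nat).
Hypothesis pchar_k : p \in [pchar k].
Hypothesis m_p' : ~~ (p %| m)%N.

(** If [w] differs from 1 then [1 + w + ... + w ^+ m.-1] is 0, but it reduces to
    [m], which is nonzero in [k]. *)
Lemma red_unity_eq1 (w : R) : w ^+ m = 1 -> red w = 1 -> w = 1.
Proof.
move=> wm red_w; apply/eqP; rewrite -subr_eq0.
have /eqP : (w - 1) * \sum_(i < m) w ^+ i = 0 by rewrite -subrX1 wm subrr.
rewrite mulf_eq0 => /orP[// | /eqP/(congr1 red)/eqP].
rewrite rmorph_sum rmorph0 (eq_bigr (fun=> 1)); last first.
  by move=> i _; rewrite rmorphXn red_w expr1n.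
by rewrite sumr_const card_ord -(dvdn_pcharf pchar_k) (negPf m_p').
Qed.

Lemma red_unity_inj (w w' : R) :
  w ^+ m = 1 -> w' ^+ m = 1 -> red w = red w' -> w = w'.
Proof.
have m_gt0 : (0 < m)%N by case: (m) m_p'; rewrite ?dvdn0.
move=> wm wm' eq_red.
have w'V : w' * w' ^+ m.-1 = 1 by rewrite -exprS prednK.
have /eqP : w * w' ^+ m.-1 = 1.
  apply: red_unity_eq1; first by rewrite exprMn wm exprAC wm' expr1n mulr1.
  by rewrite rmorphM eq_red -rmorphM w'V rmorph1.
rewrite -w'V (inj_eq (mulIf _)) => [/eqP // |].
by apply/eqP => w'0; move/eqP: w'V; rewrite w'0 mulr0 eq_sym oner_eq0.
Qed.

Lemma prim_root_red (w : R) : m.-primitive_root w -> m.-primitive_root (red w).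
Proof.
move=> w_prim; have wm := prim_expr_order w_prim.
have [m' rw_prim m'_m] : {m' | m'.-primitive_root (red w) & (m' %| m)%N}.
  by apply: prim_order_exists (prim_order_gt0 w_prim) _; rewrite -rmorphXn wm rmorph1.
suff /eqP eq_m : m' == m by rewrite -eq_m.
rewrite eqn_dvd m'_m (prim_order_dvd w_prim) /=.
apply/eqP/red_unity_eq1; first by rewrite exprAC wm expr1n.
by rewrite rmorphXn (prim_expr_order rw_prim).
Qed.

Lemma lift_root_of_unityK (w : R) :
  w ^+ m = 1 -> lift_root_of_unity red m (red w) = w.
Proof.
move=> wm; rewrite /lift_root_of_unity; case: xgetP => [w' _ [w'm]|/(_ w)].
  exact: red_unity_inj.
by case.
Qed.

End Unity.

(** * Diagonalization and Brauer character values *)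

Lemma char_poly_simmx (R : comNzRingType) n (A P Q : 'M[R]_n) :
  P *m Q = 1%:M -> char_poly (P *m A *m Q) = char_poly A.
Proof.
move=> PQ; rewrite /char_poly.
have -> : char_poly_mx (P *m A *m Q)
    = map_mx polyC P *m char_poly_mx A *m map_mx polyC Q.
  rewrite /char_poly_mx mulmxBr mulmxBl !map_mxM; congr (_ - _).
  by rewrite scalar_mxC -mulmxA -map_mxM PQ map_mx1 mulmx1.
rewrite !det_mulmx mulrAC -det_mulmx -map_mxM PQ map_mx1 det1 mul1r //.
Qed.

Lemma eigenvalues_simmx (F : fieldType) n (A P Q : 'M[F]_n) :
  P *m Q = 1%:M -> eigenvalues (P *m A *m Q) = eigenvalues A.
Proof. by move=> PQ; rewrite /eigenvalues char_poly_simmx. Qed.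

Lemma perm_prod_XsubC (F : fieldType) (s t : seq F) :
  \prod_(a <- s) ('X - a%:P) = \prod_(a <- t) ('X - a%:P) -> perm_eq s t.
Proof.
move=> eq_st; apply/allP => a _ /=.
by rewrite -!mu_prod_XsubC eq_st.
Qed.

(** [B] is annihilated by ['X^m - 1], which has the distinct roots [z ^+ i]. *)
Lemma diagonalizable_unity (k : fieldType) (m n : nat) (z : k) (B : 'M[k]_n) :
    m.-primitive_root z -> B ^+ m = 1 ->
  exists (P Q : 'M[k]_n) (d : 'rV[k]_n),
    [/\ P *m Q = 1%:M, Q *m P = 1%:M, B = P *m diag_mx d *m Q
      & forall i, d 0 i ^+ m = 1].
Proof.
case: n B => [|n] B z_prim Bm.
  by exists 1%:M, 1%:M, 0; split=> [|||[]//]; apply/matrixP => -[].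
have [P Pu /(similar_diagLR Pu) [d defB]] :
    exists2 P : 'M_n.+1, P \in unitmx & mxred.similar_to P B is_diag_mx.
  apply/mxred.diagonalizableP; exists [seq z ^+ i | i <- index_iota 0 m].
    rewrite map_inj_in_uniq ?iota_uniq // => i j.
    rewrite !mem_index_iota /= => i_lt j_lt /eqP.
    by rewrite (eq_prim_root_expr z_prim) !modn_small // => /eqP.
  rewrite big_map factor_Xn_sub_1 //; apply/mxminpoly_minP.
  by rewrite rmorphB rmorphXn rmorph1 /= horner_mx_X Bm subrr.
rewrite conjVmx // in defB.
exists (invmx P), P, d; split; rewrite ?mulVmx ?mulmxV //.
have : diag_mx d ^+ m = 1.
  have -> : diag_mx d = P * B * invmx P.
    by rewrite !mulr_mxE defB !mulmxA mulmxV // mul1mx mulmxK.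
  have PVP : invmx P * P = 1 by rewrite mulr_mxE mulVmx.
  rewrite (_ : (P * B * invmx P) ^+ m = P * B ^+ m * invmx P).
    by rewrite Bm mulr1 mulr_mxE mulmxV.
  elim: (m) => [|j IHj]; first by rewrite !expr0 mulr1 mulr_mxE mulmxV.
  by rewrite exprSr IHj exprSr !mulrA -(mulrA _ (invmx P)) PVP mulr1.
by rewrite diag_mx_exp => /matrixP dm i; have := dm i i; rewrite !mxE eqxx.
Qed.

(** The base change to eigenvectors stays over [k]; only the eigenvalues are
    lifted, to [m]-th roots of unity. *)
Definition lifted_diagonalization (R : idomainType) (k : fieldType)
    (red : {rmorphism R -> k}) (m n : nat) (B : 'M[k]_n)
    (P Q : 'M[k]_n) (d : 'rV[R]_n) : Prop :=
  [/\ P *m Q = 1%:M, Q *m P = 1%:M, B = P *m diag_mx (map_mx red d) *m Q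
    & forall i, d 0 i ^+ m = 1].

Section LiftedDiagonalization.
Variables (R : idomainType) (k : fieldType) (red : {rmorphism R -> k}).
Variables (p m n : nat).
Hypothesis pchar_k : p \in [pchar k].
Hypothesis m_p' : ~~ (p %| m)%N.
Implicit Types (B P Q : 'M[k]_n) (d : 'rV[R]_n).

Lemma lifted_diagonalization_exists (w : R) B :
  m.-primitive_root w -> B ^+ m = 1 ->
  exists P Q d, lifted_diagonalization red m B P Q d.
Proof.
move=> w_prim Bm; have rw_prim := prim_root_red red pchar_k m_p' w_prim.
have [P [Q [d [PQ QP defB dm]]]] := diagonalizable_unity rw_prim Bm.
have d_lift i : exists e, e ^+ m = 1 /\ red e = d 0 i.
  have [j def_d] := prim_rootP rw_prim (dm i).
  exists (w ^+ j); rewrite rmorphXn; split=> //.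
  by rewrite exprAC (prim_expr_order w_prim) expr1n.
have [e eP] := choice d_lift.
exists P, Q, (\row_i e i); split=> // [|i]; last by rewrite mxE; case: (eP i).
rewrite defB; congr (_ *m diag_mx _ *m _).
by apply/rowP => i; rewrite !mxE; case: (eP i).
Qed.

Lemma lifted_diagonalizationX q B P Q d :
  lifted_diagonalization red m B P Q d ->
  lifted_diagonalization red m (B ^+ q) P Q (map_mx (fun a => a ^+ q) d).
Proof.
case=> PQ QP -> dm; split=> // [|i]; last by rewrite mxE exprAC dm expr1n.
have -> : map_mx red (map_mx (fun a => a ^+ q) d)
    = map_mx (fun a => a ^+ q) (map_mx red d).
  by apply/rowP => i; rewrite !mxE rmorphXn.
rewrite -diag_mx_exp; elim: q => [|q IHq].
  by rewrite !expr0 mulmx1 PQ.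
rewrite [LHS]exprSr IHq [in RHS]exprSr !mulr_mxE !mulmxA.
by rewrite -(mulmxA _ Q P) QP mulmx1.
Qed.

(** The eigenvalues are those of the diagonal form, and each of them has a single
    lift of order dividing [m]. *)
Lemma sum_lift_eigenvalues B P Q d :
  lifted_diagonalization red m B P Q d ->
  \sum_(a <- eigenvalues B) lift_root_of_unity red m a = \sum_i d 0 i.
Proof.
case=> PQ QP defB dm.
have B_split : char_poly B = \prod_(a <- [seq red (d 0 i) | i <- enum 'I_n]) ('X - a%:P).
  rewrite defB char_poly_simmx // char_poly_trig ?diag_mx_is_trig //.
  rewrite big_map big_enum; apply: eq_bigr => i _.
  by rewrite !mxE eqxx.
have -> : \sum_i d 0 i
    = \sum_(a <- [seq red (d 0 i) | i <- enum 'I_n]) lift_root_of_unity red m a.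
  rewrite big_map big_enum; apply: eq_bigr => i _.
  by rewrite (lift_root_of_unityK red pchar_k m_p').
apply/perm_big/perm_prod_XsubC; rewrite -B_split.
by rewrite /eigenvalues; case: xgetP => [s _ <-|/(_ _ B_split)].
Qed.

End LiftedDiagonalization.

(** * The group ring *)

Section GroupRing.
Variables (R : nzRingType) (gT : finGroupType).
Implicit Types u v : gpring R gT.

Lemma gpring_mulE u v (g : gT) :
  (u * v) g = \sum_(h : gT) u h * v (h^-1 * g)%g.
Proof. by rewrite -[LHS]/(gpring_mul u v g) ffunE. Qed.

Lemma gpring_oneE (g : gT) : (1 : gpring R gT) g = (g == 1%g)%:R.
Proof. by rewrite -[LHS]/(gpring_elt R 1%g g) ffunE. Qed.

Lemma gpring_eltM (g h : gT) :
  gpring_elt R (g * h)%g = gpring_elt R g * gpring_elt R h.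
Proof.
apply/ffunP => x; rewrite gpring_mulE (bigD1 g) //= big1 => [|y /negPf yg].
  by rewrite !ffunE eqxx mul1r addr0 (can2_eq (mulKVg g) (mulKg g)).
by rewrite ffunE yg mul0r.
Qed.

Lemma gpring_elt_inj : injective (gpring_elt R (gT := gT)).
Proof.
move=> g h /ffunP/(_ g)/eqP; rewrite !ffunE eqxx; case: (g =P h) => // _.
by rewrite oner_eq0.
Qed.

Lemma gpring_eltX (g : gT) n : gpring_elt R (g ^+ n)%g = gpring_elt R g ^+ n.
Proof. by elim: n => // n IHn; rewrite expgS exprS gpring_eltM IHn. Qed.

Lemma torsion_orderP u : torsion u ->
  [/\ (0 < torsion_order u)%N, u ^+ torsion_order u = 1
    & forall m, (0 < m)%N -> u ^+ m = 1 -> (torsion_order u <= m)%N].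
Proof.
move=> [n n_gt0 un].
have exn : exists m, (0 < m)%N && (u ^+ m == 1) by exists n; rewrite n_gt0 un eqxx.
have [m /andP[m_gt0 /eqP um] m_min] := ex_minnP exn.
suff exP : exists j, [/\ (0 < j)%N, u ^+ j = 1
    & forall i, (0 < i)%N -> u ^+ i = 1 -> (j <= i)%N] by exact: xgetPex exP.
by exists m; split=> // j j_gt0 uj; apply: m_min; rewrite j_gt0 uj eqxx.
Qed.

Lemma gpring_elt_expg_order (g : gT) : gpring_elt R g ^+ #[g]%g = 1.
Proof. by rewrite -gpring_eltX expg_order. Qed.

Lemma torsion_order_elt (g : gT) : torsion_order (gpring_elt R g) = #[g]%g.
Proof.
have g_tors : torsion (gpring_elt R g).
  by exists #[g]%g; rewrite ?order_gt0 // gpring_elt_expg_order.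
have [m_gt0 gm m_min] := torsion_orderP g_tors.
apply/eqP; rewrite eqn_leq m_min ?order_gt0 ?gpring_elt_expg_order //=.
apply: dvdn_leq => //; rewrite order_dvdn; apply/eqP/gpring_elt_inj.
by rewrite gpring_eltX gm.
Qed.

End GroupRing.

(** The coefficient of [u ^+ n] at [g] is the sum, over the words of length [n] with
    product [g], of the products of the coefficients of [u]. *)
Lemma sum_gpring_exp (R R' : comNzRingType) (i : {rmorphism R -> R'})
    (gT : finGroupType) (F : gT -> R') (u : gpring R gT) n :
  \sum_g i ((u ^+ n) g) * F g
  = \sum_(w : n.-tuple gT) (\prod_(h <- w) i (u h)) * F (\prod_(h <- w) h)%g.
Proof.
pose b (h : gT) : gpring R gT := [ffun g => u h *+ (g == h)].
have prod_b (w : seq gT) g : (\prod_(h <- w) b h) g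
    = (\prod_(h <- w) u h) *+ (g == \prod_(h <- w) h)%g.
  elim: w g => [|h w IHw] g; first by rewrite !big_nil gpring_oneE.
  rewrite !big_cons gpring_mulE (bigD1 h) //= [X in _ + X]big1 => [|x /negPf xh].
    by rewrite ffunE eqxx IHw addr0 mulrnAr (can2_eq (mulKVg h) (mulKg h)).
  by rewrite ffunE xh mul0r.
have u_sum : u = \sum_h b h.
  apply/ffunP => g; rewrite sum_ffunE (bigD1 g) //= big1 => [|h /negPf hg].
    by rewrite ffunE eqxx addr0.
  by rewrite ffunE eq_sym hg.
rewrite [in LHS]u_sum expr_sum_words.
under eq_bigr => g _ do rewrite sum_ffunE rmorph_sum mulr_suml.
rewrite exchange_big /=; apply: eq_bigr => w _.
rewrite (bigD1 (\prod_(h <- w) h)%g) //= [X in _ + X]big1 => [|g /negPf gw].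
  by rewrite prod_b eqxx rmorph_prod addr0.
by rewrite prod_b gw rmorph0 mul0r.
Qed.

(** * Brauer characters and words in the group *)

Section PModularSystem.
Variables (p : nat) (S : pmodular_system p).

Lemma ms_dvr : discrete_valuation_ring (ms_incl S).
Proof. by case: S. Qed.

Lemma ms_prime_pi : prime_element (ms_pi S).
Proof. by case: S. Qed.

Lemma ms_red_surj (b : msk S) : exists a, ms_red S a = b.
Proof. by case: S b. Qed.

Lemma ms_red_ker (a : msR S) : ms_red S a = 0 <-> rdivides (ms_pi S) a.
Proof. by case: S a. Qed.

Lemma ms_pchar : p \in [pchar (msk S)].
Proof. by case: S. Qed.

End PModularSystem.

Lemma enl_red (p : nat) (S S' : pmodular_system p) (E : enlargement S S') a :
  enl_k E (ms_red S a) = ms_red S' (enl_R E a).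
Proof. by case: E. Qed.

Section Representation.
Variables (p : nat) (gT : finGroupType) (n : nat) (S : pmodular_system p).
Variable Theta : mx_representation (msk S) [set: gT] n.
Implicit Types u v : gpring (msR S) gT.

Lemma gpring_repr_elt g : gpring_repr Theta (gpring_elt (msR S) g) = Theta g.
Proof.
rewrite /gpring_repr (bigD1 g) //= big1 => [|h /negPf hg].
  by rewrite ffunE eqxx rmorph1 scale1r addr0.
by rewrite ffunE hg rmorph0 scale0r.
Qed.

Lemma gpring_reprM u v :
  gpring_repr Theta (u * v) = gpring_repr Theta u *m gpring_repr Theta v.
Proof.
rewrite {2}/gpring_repr mulmx_suml.
under [RHS]eq_bigr => h _ do rewrite mulmx_sumr (reindex_inj (mulgI h^-1)%g).
rewrite /gpring_repr exchange_big /=; apply: eq_bigr => g _.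
rewrite gpring_mulE rmorph_sum scaler_suml; apply: eq_bigr => h _.
rewrite -scalemxAl -scalemxAr scalerA -rmorphM -repr_mxM ?finset.in_setT //.
by rewrite mulKVg.
Qed.

Lemma gpring_reprX u q : gpring_repr Theta (u ^+ q) = gpring_repr Theta u ^+ q.
Proof.
elim: q => [|q IHq].
  by rewrite !expr0 -[1]/(gpring_elt (msR S) 1%g) gpring_repr_elt repr_mx1.
by rewrite !exprS gpring_reprM IHq.
Qed.

End Representation.

Section BrauerCharacterValues.
Variables (p : nat) (gT : finGroupType) (n : nat).
Variables (S S' : pmodular_system p) (E : enlargement S S').
Variable Theta : mx_representation (msk S) [set: gT] n.
Hypothesis p_pr : prime p.

Local Notation R := (msR S).
Local Notation R' := (msR S').
Local Notation pi := (ms_pi S').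
Local Notation red := (ms_red S').
Local Notation brauer := (brauer_character E Theta).
Local Notation elt := (gpring_elt R).
Local Notation rho u := (map_mx (enl_k E) (gpring_repr Theta u)).

Lemma rhoX u q : rho (u ^+ q) = rho u ^+ q.
Proof.
rewrite gpring_reprX; elim: q => [|q IHq]; first by rewrite !expr0 map_mx1.
by rewrite !exprS !mulr_mxE map_mxM IHq.
Qed.

Lemma brauer_character_diag (u : gpring R gT) :
    torsion u -> ~~ (p %| torsion_order u)%N ->
    (exists z : msK S', (torsion_order u).-primitive_root z) ->
  exists P Q d, lifted_diagonalization red (torsion_order u) (rho u) P Q d.
Proof.
move=> /torsion_orderP[m_gt0 um _] m_p' [z z_prim].
have [w w_prim] := prim_root_valuation_ring (ms_dvr S') z_prim.
apply: (lifted_diagonalization_exists red (ms_pchar S') m_p' w_prim).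
by rewrite -rhoX um -(expr0 u) rhoX.
Qed.

Lemma brauer_characterE u P Q d :
    ~~ (p %| torsion_order u)%N ->
    lifted_diagonalization red (torsion_order u) (rho u) P Q d ->
  brauer u = \sum_i d 0 i.
Proof. by move=> m_p'; apply: (sum_lift_eigenvalues (ms_pchar S') m_p'). Qed.

Lemma brauer_character_conjg (g h : gT) : brauer (elt (g ^ h)%g) = brauer (elt g).
Proof.
rewrite /brauer_character (torsion_order_elt _ g) (torsion_order_elt _ (g ^ h)).
rewrite orderJ (gpring_repr_elt _ g) (gpring_repr_elt _ (g ^ h)) conjgE.
have ThetaM x y : Theta (x * y)%g = Theta x *m Theta y.
  by rewrite repr_mxM ?finset.in_setT.
rewrite !ThetaM mulmxA !map_mxM eigenvalues_simmx //.
by rewrite -map_mxM -ThetaM mulVg repr_mx1 map_mx1.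
Qed.

(** Extending by 0 gives a class function on all of the group, which can be
    evaluated at the products of arbitrary words. *)
Definition brauer_extension (g : gT) : R' :=
  if p_regular_elt p g then brauer (elt g) else 0.

Lemma brauer_extension_conjg g h : brauer_extension (g ^ h)%g = brauer_extension g.
Proof.
by rewrite /brauer_extension /p_regular_elt orderJ brauer_character_conjg.
Qed.

Lemma brauer_extension_mulC g h : brauer_extension (g * h)%g = brauer_extension (h * g)%g.
Proof. by rewrite -[RHS](brauer_extension_conjg _ g^-1) conjgE invgK !mulgA mulgK. Qed.

Hypothesis largeK' : forall g : gT, exists z : msK S', #[g]%g.-primitive_root z.

Let a := logn p #|gT|.

(** Raising to the power [p ^ a] kills the p-part of every element. *)
Lemma p_regular_expg (g : gT) t : (a <= t)%N -> p_regular_elt p (g ^+ (p ^ t))%g.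
Proof.
move=> a_le; rewrite /p_regular_elt -prime_coprime //.
have gT_gt0 : (0 < #|gT|)%N by rewrite -cardsT cardG_gt0.
have [m p_m def_gT] := pfactor_coprime p_pr gT_gt0.
apply: (coprime_dvdr _ p_m); rewrite order_dvdn -expgM -(subnKC a_le) expnD.
rewrite mulnC mulnA -def_gT expgM -cardsT.
by rewrite (expg_cardG (G := [set: gT]%G)) ?finset.in_setT // expg1n.
Qed.

(** The matrix [rho (elt g)] may fail to be diagonalizable when [g] is p-singular, so
    [a] of the [t] factors [p] are spent on replacing [g] by the p-regular element
    [g ^+ (p ^ a)].  The remaining factors carry the eigenvalues of
    that element, and their lifts, to those of [g ^+ (p ^ t)]. *)
Lemma trace_lift_brauer_extension g (M : 'M[R']_n) t :
  map_mx red M = rho (elt g) ->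
  rdivides (pi ^+ (t - a)) (\tr (M ^+ (p ^ t)) - brauer_extension (g ^+ (p ^ t))%g).
Proof.
move=> redM; case: (leqP a t) => [a_le | t_lt]; last first.
  by rewrite (eqP (ltnW t_lt)) expr0; apply: rdivides1.
set h := (g ^+ (p ^ a))%g; set q := (p ^ (t - a))%N.
have pt : (p ^ t = p ^ a * q)%N by rewrite /q -expnD subnKC.
have h_reg : p_regular_elt p h by apply: p_regular_expg.
have hq_ord : #[h ^+ q]%g = #[h]%g.
  rewrite orderXgcd (eqP (_ : coprime _ _)) ?divn1 //.
  by rewrite coprime_sym coprimeXl // prime_coprime.
have h_tors : torsion (elt h).
  by exists #[h]%g; rewrite ?order_gt0 // gpring_elt_expg_order.
have [||P [Q [d diag_h]]] := brauer_character_diag h_tors.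
- by rewrite torsion_order_elt.
- by rewrite torsion_order_elt; apply: largeK'.
have diag_hq : lifted_diagonalization red (torsion_order (elt (h ^+ q)%g))
    (rho (elt (h ^+ q)%g)) P Q (map_mx (fun b => b ^+ q) d).
  rewrite torsion_order_elt hq_ord -(torsion_order_elt R h) gpring_eltX rhoX.
  exact: lifted_diagonalizationX.
rewrite pt expgM -/h /brauer_extension ifT; last by rewrite /p_regular_elt hq_ord.
rewrite (brauer_characterE _ diag_hq) ?torsion_order_elt ?hq_ord // exprM.
under [X in _ - X]eq_bigr => i _ do rewrite mxE.
apply: (@rdivides_leX _ _ _ (t - a).+1); first exact: leqnSn.
case: diag_h => _ QP rho_h _.
apply: (rdivides_trace_exp_diag p_pr (@ms_red_surj _ S') (@ms_red_ker _ S')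
  (ms_pchar S') _ QP).
rewrite -rho_h gpring_eltX rhoX -redM.
elim: (p ^ a)%N => [|j IHj]; first by rewrite !expr0 map_mx1.
by rewrite !exprS !mulr_mxE map_mxM IHj.
Qed.

(** The difference is a sum over words of length [p ^ N] of a rotation-invariant
    function [f].  On an orbit of size [p ^ j], the factor [p ^ j] provides
    [pi ^+ j] and the comparison of traces with Brauer values provides
    [pi ^+ (N - j - a)]. *)
Lemma trace_word_congruence (u : gpring R gT) (That : gT -> 'M[R']_n) N :
    (forall g, map_mx red (That g) = rho (elt g)) ->
  rdivides (pi ^+ (N - a))
    (\tr ((\sum_g enl_R E (u g) *: That g) ^+ (p ^ N))
     - \sum_g enl_R E ((u ^+ (p ^ N)) g) * brauer_extension g).
Proof.
move=> redThat.
have red_prod (v : seq gT) :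
    map_mx red (\prod_(g <- v) That g) = rho (elt (\prod_(g <- v) g)%g).
  elim: v => [|g v IHv].
    by rewrite !big_nil map_mx1 gpring_repr_elt repr_mx1 map_mx1.
  rewrite !big_cons mulr_mxE map_mxM IHv redThat.
  by rewrite (gpring_eltM _ g) gpring_reprM map_mxM.
pose f (w : seq gT) := (\prod_(g <- w) enl_R E (u g)) *
  (\tr (\prod_(g <- w) That g) - brauer_extension (\prod_(g <- w) g)%g).
have -> : \tr ((\sum_g enl_R E (u g) *: That g) ^+ (p ^ N))
     - \sum_g enl_R E ((u ^+ (p ^ N)) g) * brauer_extension g
    = \sum_(w : (p ^ N).-tuple gT) f w.
  rewrite expr_sum_words raddf_sum (sum_gpring_exp (enl_R E)) -sumrB.
  apply: eq_bigr => w _; rewrite /f mulrBr -mxtraceZ; congr (\tr _ - _).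
  elim: (tval w) => [|g v IHv]; first by rewrite !big_nil scale1r.
  by rewrite !big_cons IHv !mulr_mxE -scalemxAl -scalemxAr scalerA.
apply: cyclic_word_sum; first by rewrite expn_gt0 prime_gt0.
- move=> v w; rewrite /f; congr (_ * (_ - _)).
  + by rewrite !big_cat /= mulrC.
  + exact: mxtrace_prod_cat.
  + by rewrite !big_cat /= brauer_extension_mulC.
- exact: rdivides0.
- by move=> b c; apply: rdividesD.
move=> d q v dq _; rewrite /f.
have [j j_le def_d] : exists2 j, (j <= N)%N & d = (p ^ j)%N.
  by apply/dvdn_pfactor => //; apply/dvdnP; exists q; rewrite mulnC.
have def_q : q = (p ^ (N - j))%N.
  apply/eqP; rewrite -(eqn_pmul2l (_ : 0 < d)%N) ?dq ?def_d -?expnD ?subnKC //.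
  by rewrite expn_gt0 prime_gt0.
rewrite -mulr_natl mulrCA; apply: rdivides_mull.
apply: (@rdivides_leX _ _ _ (j + (N - j - a))).
  by rewrite subnAC -leq_subLR.
rewrite exprD; apply: rdividesM.
  rewrite def_d natrX; apply: rdividesX.
  exact: (rdivides_pi_p (@ms_red_ker _ S') (ms_pchar S')).
rewrite prod_repeat_word prodg_repeat_word def_q.
exact: trace_lift_brauer_extension.
Qed.

(** For infinitely many [N], namely the multiples of the totient of the order of
    [u], both [u] and the lifted eigenvalues are fixed by raising to the power
    [p ^ N]. *)
Lemma brauer_character_sum_extension (u : gpring R gT) :
    torsion u -> ~~ (p %| torsion_order u)%N ->
    (exists z : msK S', (torsion_order u).-primitive_root z) ->
  brauer u = \sum_g enl_R E (u g) * brauer_extension g.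
Proof.
move=> u_tors m_p' largeKu; have [m_gt0 um _] := torsion_orderP u_tors.
set m := torsion_order u in m_gt0 um.
have [P [Q [d diag_u]]] := brauer_character_diag u_tors m_p' largeKu.
rewrite (brauer_characterE m_p' diag_u); have [_ QP rho_u dm] := diag_u.
apply/eqP; rewrite -subr_eq0; apply/eqP.
apply: (rdivides_all_powers_eq0 (ms_dvr S') (ms_prime_pi S')) => c.
pose N := (totient m * (c + a))%N.
have pN : (p ^ N = 1 %[mod m])%N.
  rewrite expnM -modnXm Euler_exp_totient ?modnXm ?exp1n //.
  by rewrite prime_coprime.
have cN : (c <= N - a)%N.
  by rewrite -{1}(addnK a c) leq_sub2r // leq_pmull ?totient_gt0.
have uN : u ^+ (p ^ N) = u by rewrite -(expr_mod _ um) pN expr_mod // expr1.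
have dN i : d 0 i ^+ (p ^ N) = d 0 i.
  by rewrite -(expr_mod _ (dm i)) pN expr_mod // expr1.
have [That redThat] := choice (fun g => lift_mx (@ms_red_surj _ S') (rho (elt g))).
have redA : map_mx red (\sum_g enl_R E (u g) *: That g)
    = P *m diag_mx (map_mx red d) *m Q.
  rewrite -rho_u /gpring_repr !raddf_sum /=; apply: eq_bigr => g _.
  by rewrite !map_mxZ redThat gpring_repr_elt enl_red.
have trA := rdivides_trace_exp_diag p_pr (@ms_red_surj _ S') (@ms_red_ker _ S')
  (ms_pchar S') N QP redA.
rewrite (eq_bigr (fun i => d 0 i) (fun i _ => dN i)) in trA.
apply: (@rdivides_leX _ _ _ (N - a)) => //.
apply: (@rdivides_sub_trans _ (\tr ((\sum_g enl_R E (u g) *: That g) ^+ (p ^ N)))).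
  apply: rdivides_subC; apply: rdivides_leX trA.
  exact: leq_trans (leq_subr _ _) (leqnSn _).
by have := trace_word_congruence u N redThat; rewrite uN.
Qed.

End BrauerCharacterValues.

Lemma p_regular_class_sum (gT : finGroupType) (p r : nat) (x : 'I_r -> gT)
    (V : zmodType) (f : gT -> V) :
    p_regular_class_reps p x -> (forall g, ~~ p_regular_elt p g -> f g = 0) ->
  \sum_g f g = \sum_l \sum_(g in (x l ^: [set: gT])%g) f g.
Proof.
move=> [_ x_inj x_cover] f0.
rewrite [RHS](exchange_big_dep predT) //=; apply: eq_bigr => g _.
have [g_reg | g_sing] := boolP (p_regular_elt p g); last first.
  by rewrite big1 ?f0.
have [l gl] := x_cover g g_reg.
rewrite (big_pred1 l) // => j /=; apply/idP/eqP => [gj | -> //].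
by apply: x_inj; rewrite -(class_eqP gj) (class_eqP gl) class_refl.
Qed.

Theorem theorem3p2 (gT : finGroupType) (p : nat)
  (p_prime : prime p) (p_dvd : (p %| #|gT|)%N)
  (S : pmodular_system p)
  (charK : [pchar (msK S)] =i pred0)
  (largeK : sufficiently_large (msK S) gT)
  (r : nat) (x : 'I_r -> gT) (x_reps : p_regular_class_reps p x)
  (n : nat) (Theta : mx_representation (msk S) [set: gT] n)
  (u : gpring (msR S) gT)
  (u_unit : normalized_unit u) (u_reg : p_regular_torsion p u)
  (S' : pmodular_system p) (E : enlargement S S')
  (largeK' : exists z : msK S', (torsion_order u).-primitive_root z) :
  brauer_character E Theta u =
    \sum_(l < r) enl_R E (partial_augmentation u (x l)) *
                 brauer_character E Theta (gpring_elt (msR S) (x l)).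
Proof.
have largeK'_elt (g : gT) : exists z : msK S', #[g]%g.-primitive_root z.
  have [z z_prim] := largeK; have g_exp := dvdn_exponent (finset.in_setT g).
  rewrite -(fmorph_primitive_root (enl_K E)) in z_prim.
  by eexists; apply: dvdn_prim_root z_prim _ g_exp.
have [u_tors m_p'] := u_reg.
rewrite (brauer_character_sum_extension E Theta p_prime largeK'_elt) //.
rewrite (p_regular_class_sum x_reps) => [|g /negPf g_sing]; last first.
  by rewrite /brauer_extension g_sing mulr0.
apply: eq_bigr => l _; rewrite /partial_augmentation rmorph_sum mulr_suml.
apply: eq_bigr => g /imsetP[h _ ->]; rewrite brauer_extension_conjg.
by rewrite /brauer_extension; case: x_reps => ->.
Qed.
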